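(* Let $a_c>b_c>0$, $k_e>0$, $a_e^2=a_c^2+k_e$, $b_e^2=b_c^2+k_e$, let $c$ be the ellipse $x^2/a_c^2+y^2/b_c^2=1$ and $e$ the ellipse $x^2/a_e^2+y^2/b_e^2=1$. Let $\dots P_0P_1P_2\dots$ be a billiard in $e$ with caustic $c$, whose side $[P_i,P_{i+1}]$ touches $c$ at $Q_i$ ($i\in\mathbb Z$). For $i\in\mathbb Z$ and $j=1,2,\dots$ define the points (in the real projective plane) $$S_i^{(j)}=\begin{cases}[P_{i-k-1},P_{i-k}]\cap[P_{i+k},P_{i+k+1}] & \text{if } j=2k,\\ [P_{i-k},P_{i-k+1}]\cap[P_{i+k},P_{i+k+1}] & \text{if } j=2k-1.\end{cases}$$ Then: (1) The points $S_i^{(1)},S_i^{(3)},\dots$ lie on the hyperbola of the confocal family through $Q_i$, and the points $S_i^{(2)},S_i^{(4)},\dots$ lie on the hyperbola of the confocal family through $P_i$. (2) For each $j\in\{1,2,\dots\}$ there is a member $e^{(j)}$ of the confocal family, or a degenerate limit of it (one of the two coordinate axes or the line at infinity), containing all points $S_i^{(j)}$, $i\in\mathbb Z$; if $e^{(j)}$ is a regular (ellipse) member, then the points $\dots,S_i^{(j)},S_{i+(j+1)}^{(j)},S_{i+2(j+1)}^{(j)},\dots$ are the consecutive vertices of a billiard in the ellipse $e^{(j)}$ with caustic $c$. The conic $e^{(j)}$ does not depend on the choice of the billiard in $e$ with caustic $c$ (i.e. on the position of the initial vertex $P_0\in e$), but only on $e$, $c$ and $j$.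
   Context: The confocal family is $x^2/(a_c^2+k)+y^2/(b_c^2+k)=1$, $k\in\mathbb R\setminus\{-a_c^2,-b_c^2\}$, consisting of ellipses for $k>-b_c^2$ and hyperbolas for $-a_c^2<k<-b_c^2$; $c$ is the member $k=0$ and $e$ the member $k=k_e$. A billiard in an ellipse $E$ of the family with caustic $c$ (where $c$ lies inside $E$) is a sequence $(P_i)_{i\in\mathbb Z}$ of points of $E$ with $P_{i+1}\neq P_i$ such that every line $[P_i,P_{i+1}]$ is tangent to $c$ and $[P_{i-1},P_i]\neq[P_i,P_{i+1}]$, i.e. the two sides at each vertex are the two tangents from it to $c$. *)

(* Defs.v *)
From Stdlib Require Import Reals ZArith.
Open Scope R_scope.

Definition pt := (R * R)%type.

(* Homogeneous coordinates of the real projective plane (a vector of R^3;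
   the zero vector is not a projective point). *)
Record hvec := HV { hx : R; hy : R; hz : R }.

Definition hom (A : pt) : hvec := HV (fst A) (snd A) 1.

Definition cross (u v : hvec) : hvec :=
  HV (hy u * hz v - hz u * hy v)
     (hz u * hx v - hx u * hz v)
     (hx u * hy v - hy u * hx v).

Definition hscale (l : R) (u : hvec) : hvec := HV (l * hx u) (l * hy u) (l * hz u).

Definition line_of (A B : pt) : hvec := cross (hom A) (hom B).

(* Intersection point (in the projective plane) of two lines, in homogeneous
   coordinates; it is the zero vector iff the two lines coincide. *)
Definition meet (L M : hvec) : hvec := cross L M.

Definition on_line (A B X : pt) : Prop :=
  (fst B - fst A) * (snd X - snd A) - (snd B - snd A) * (fst X - fst A) = 0.

Definition same_line (A B C D : pt) : Prop :=
  forall X, on_line A B X <-> on_line C D X.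

(* Confocal family with parameters a, b (here a = a_c, b = b_c):
   x^2/(a^2+k) + y^2/(b^2+k) = 1, k <> -a^2, -b^2,
   together with its three degenerate limits. *)
Inductive confocal :=
  | Member (k : R)
  | XAxis            (* limit k -> -b^2 : the line y = 0 *)
  | YAxis            (* limit k -> -a^2 : the line x = 0 *)
  | LineInf.         (* limit k -> +oo  : the line at infinity z = 0 *)

Definition valid_member (a b : R) (m : confocal) : Prop :=
  match m with
  | Member k => k <> - a ^ 2 /\ k <> - b ^ 2
  | _ => True
  end.

Definition on_member (a b : R) (m : confocal) (v : hvec) : Prop :=
  match m with
  | Member k => hx v ^ 2 / (a ^ 2 + k) + hy v ^ 2 / (b ^ 2 + k) = hz v ^ 2
  | XAxis => hy v = 0
  | YAxis => hx v = 0
  | LineInf => hz v = 0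
  end.

Definition is_ellipse_member (a b : R) (m : confocal) : Prop :=
  match m with
  | Member k => - b ^ 2 < k
  | _ => False
  end.

Definition is_hyperbola_or_axis (a b : R) (m : confocal) : Prop :=
  match m with
  | Member k => - a ^ 2 < k < - b ^ 2
  | XAxis | YAxis => True
  | LineInf => False
  end.

Definition on_conic (a b k : R) (X : pt) : Prop :=
  fst X ^ 2 / (a ^ 2 + k) + snd X ^ 2 / (b ^ 2 + k) = 1.

(* The line [A,B] (A <> B) touches the caustic c : x^2/a^2+y^2/b^2 = 1 at Q:
   Q lies on c and A, B lie on the tangent line of c at Q. *)
Definition touches (a b : R) (A B Q : pt) : Prop :=
  on_conic a b 0 Q /\
  fst A * fst Q / a ^ 2 + snd A * snd Q / b ^ 2 = 1 /\
  fst B * fst Q / a ^ 2 + snd B * snd Q / b ^ 2 = 1.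

Definition billiard (a b k : R) (P : Z -> pt) : Prop :=
  forall i : Z,
    on_conic a b k (P i) /\
    P (i + 1)%Z <> P i /\
    (exists Q, touches a b (P i) (P (i + 1)%Z) Q) /\
    ~ same_line (P (i - 1)%Z) (P i) (P i) (P (i + 1)%Z).

Definition S_pt (P : Z -> pt) (i : Z) (j : nat) : hvec :=
  if Nat.even j then
    let k := Z.of_nat (Nat.div j 2) in
    meet (line_of (P (i - k - 1)%Z) (P (i - k)%Z))
         (line_of (P (i + k)%Z) (P (i + k + 1)%Z))
  else
    let k := Z.of_nat (Nat.div (j + 1) 2) in
    meet (line_of (P (i - k)%Z) (P (i - k + 1)%Z))
         (line_of (P (i + k)%Z) (P (i + k + 1)%Z)).

(* Main.v *)
(* Points of the caustic are written (a sn, b cn) with Jacobi triples (sn, cn, dn) of squared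
   modulus m = 1 - b^2/a^2. On such triples with dn > 0 the addition formulas of the Jacobi functions have
   no vanishing denominator, so they form an abelian group in which every element can be halved,
   and no analytic theory of elliptic functions is needed. The tangents at g - h and g + h meet in
   (a sn g dn h : b cn g : cn h). For fixed h these poles lie on the confocal conic with parameter
   b^2 sn^2 h / cn^2 h, for fixed g on the confocal hyperbola with a^2 + k = (a^2 - b^2) sn^2 g.
   Hence the tangents from a point of e to c have parameters differing by 2v or -2v, where v depends
   on e only, and since a billiard never turns back, the contact parameters form an arithmetic
   progression. Its half-step lattice contains the parameters g of all P_i, Q_i and S_i^(j), the
   latter with h = (j + 1) v. *)

Require Import Defs.
From Stdlib Require Import Reals ZArith Lra Lia Psatz.
Open Scope R_scope.

(** * Jacobi triples and their addition law *)

Record jac := J { sn : R; cn : R; dn : R }.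

Definition jacobi (m : R) (x : jac) : Prop :=
  cn x ^ 2 = 1 - sn x ^ 2 /\ dn x ^ 2 = 1 - m * sn x ^ 2 /\ 0 < dn x.

Definition jden (m : R) (x y : jac) : R := 1 - m * sn x ^ 2 * sn y ^ 2.

Definition jadd (m : R) (x y : jac) : jac :=
  J ((sn x * cn y * dn y + sn y * cn x * dn x) / jden m x y)
    ((cn x * cn y - sn x * sn y * dn x * dn y) / jden m x y)
    ((dn x * dn y - m * sn x * sn y * cn x * cn y) / jden m x y).

Definition jzero : jac := J 0 1 1.
Definition jneg (x : jac) : jac := J (- sn x) (cn x) (dn x).

Lemma jacobi_sn2_le1 m x : jacobi m x -> 0 <= sn x ^ 2 <= 1.
Proof. intros (H1 & _). pose proof (pow2_ge_0 (sn x)). pose proof (pow2_ge_0 (cn x)). lra. Qed.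

Lemma jden_pos m x y : 0 < m < 1 -> jacobi m x -> jacobi m y -> 0 < jden m x y.
Proof.
intros Hm Hx%jacobi_sn2_le1 Hy%jacobi_sn2_le1. unfold jden.
assert (sn x ^ 2 * sn y ^ 2 <= 1) by nra.
assert (0 <= sn x ^ 2 * sn y ^ 2) by nra.
nra.
Qed.

Lemma jac_eq x y : sn x = sn y -> cn x = cn y -> dn x = dn y -> x = y.
Proof. destruct x, y; simpl; congruence. Qed.

Lemma jadd_closed m x y : 0 < m < 1 -> jacobi m x -> jacobi m y -> jacobi m (jadd m x y).
Proof.
intros Hm Hx Hy. pose proof (jden_pos m x y Hm Hx Hy) as HD.
pose proof (jacobi_sn2_le1 _ _ Hx) as Bx. pose proof (jacobi_sn2_le1 _ _ Hy) as By.
destruct Hx as (cx & dx & px), Hy as (cy & dy & py).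
unfold jacobi; simpl sn; simpl cn; simpl dn.
assert (HD0 : jden m x y <> 0) by lra.
unfold jden in *.
repeat split.
- field_simplify_eq; auto. ring [cx cy dx dy].
- field_simplify_eq; auto. ring [cx cy dx dy].
- apply Rdiv_lt_0_compat; auto.
  pose proof (pow2_ge_0 (cn x)). pose proof (pow2_ge_0 (cn y)).
  assert ((m * sn x * sn y * cn x * cn y) ^ 2 < (dn x * dn y) ^ 2).
  { replace ((dn x * dn y) ^ 2) with (dn x ^ 2 * dn y ^ 2) by ring.
    rewrite dx, dy.
    replace ((m * sn x * sn y * cn x * cn y) ^ 2)
      with ((m * sn x ^ 2 * cn x ^ 2) * (m * sn y ^ 2 * cn y ^ 2)) by ring.
    (* The squared bound splits into one factor in x and one in y, and 1 - m t - m t (1 - t) = (1 -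
       m) + m (1 - t)^2 > 0. *)
    assert (Hb : forall t, 0 <= t <= 1 -> 0 <= m * t * (1 - t) < 1 - m * t).
    { intros t Ht. split.
      - apply Rmult_le_pos; nra.
      - pose proof (pow2_ge_0 (1 - t)). nra. }
    rewrite cx, cy. pose proof (Hb _ Bx). pose proof (Hb _ By). nra. }
  assert (0 < dn x * dn y) by nra.
  nra.
Qed.

(* The denominator of [jadd m (jadd m x y) z] after clearing [jden m x y]. *)
Lemma jadd_den2 m x y z : 0 < m < 1 -> jacobi m x -> jacobi m y -> jacobi m z ->
  0 < jden m x y ^ 2 - m * (sn x * cn y * dn y + sn y * cn x * dn x) ^ 2 * sn z ^ 2.
Proof.
intros Hm Hx Hy Hz.
pose proof (jden_pos m x y Hm Hx Hy) as HD.
pose proof (jden_pos m _ z Hm (jadd_closed m x y Hm Hx Hy) Hz) as H.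
unfold jden in H at 1; simpl sn in H.
replace (_ - _) with ((1 -
     m * ((sn x * cn y * dn y + sn y * cn x * dn x) / jden m x y) ^ 2 *
     sn z ^ 2) * jden m x y ^ 2) by (field; lra).
apply Rmult_lt_0_compat; nra.
Qed.

Lemma jadd_comm m x y : jadd m x y = jadd m y x.
Proof.
unfold jadd. replace (jden m y x) with (jden m x y) by (unfold jden; ring).
f_equal; f_equal; ring.
Qed.

(** Once the positive denominators [D1] to [D4] are cleared, each component is a polynomial identity
    modulo the quadratic relations for cn^2 and dn^2. *)
Lemma jadd_assoc m x y z : 0 < m < 1 -> jacobi m x -> jacobi m y -> jacobi m z ->
  jadd m (jadd m x y) z = jadd m x (jadd m y z).
Proof.
intros Hm Hx Hy Hz.
pose proof (jden_pos m x y Hm Hx Hy) as D1.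
pose proof (jden_pos m y z Hm Hy Hz) as D2.
pose proof (jadd_den2 m x y z Hm Hx Hy Hz) as D3.
pose proof (jadd_den2 m y z x Hm Hy Hz Hx) as D4.
destruct Hx as (cx & dx & _), Hy as (cy & dy & _), Hz as (cz & dz & _).
destruct x as [s1 c1 d1], y as [s2 c2 d2], z as [s3 c3 d3].
unfold jadd, jden in *; simpl sn in *; simpl cn in *; simpl dn in *.
apply jac_eq; simpl sn; simpl cn; simpl dn; field_simplify_eq;
  try (repeat split; lra).
all: ring [cx cy cz dx dy dz].
Qed.

Lemma jacobi_zero m : jacobi m jzero.
Proof. repeat split; simpl; lra. Qed.

Lemma jacobi_neg m x : jacobi m x -> jacobi m (jneg x).
Proof.
intros H. unfold jacobi, jneg; cbn [sn cn dn].
replace ((- sn x) ^ 2) with (sn x ^ 2) by ring. exact H.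
Qed.

(** dn is the positive root of 1 - m sn^2, so a point of the caustic determines its triple. *)
Lemma jacobi_ext m x y : jacobi m x -> jacobi m y ->
  sn x = sn y -> cn x = cn y -> x = y.
Proof.
intros (_ & Hx & px) (_ & Hy & py) Hs Hc. apply jac_eq; auto.
apply Rsqr_inj; try lra. rewrite !Rsqr_pow2. congruence.
Qed.

Lemma jadd_zero m x : jadd m x jzero = x.
Proof. apply jac_eq; unfold jden; simpl; unfold jden; simpl; field. Qed.

Lemma jneg_neg x : jneg (jneg x) = x.
Proof. apply jac_eq; simpl; ring. Qed.

Lemma jneg_add m x y : jneg (jadd m x y) = jadd m (jneg x) (jneg y).
Proof.
unfold jadd, jneg; simpl sn; simpl cn; simpl dn.
replace (jden m (J (- sn x) (cn x) (dn x)) (J (- sn y) (cn y) (dn y)))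
  with (jden m x y) by (unfold jden; simpl; ring).
unfold Rdiv. f_equal; ring.
Qed.

Lemma jadd_neg m x : 0 < m < 1 -> jacobi m x -> jadd m x (jneg x) = jzero.
Proof.
intros Hm Hx. pose proof (jden_pos m x _ Hm Hx (jacobi_neg m x Hx)) as HD.
destruct Hx as (cx & dx & _).
unfold jadd, jzero, jden in *; simpl sn in *; simpl cn in *; simpl dn in *.
apply jac_eq; simpl sn; simpl cn; simpl dn; field_simplify_eq; try lra;
  ring [cx dx].
Qed.

Lemma jadd_negK m x h : 0 < m < 1 -> jacobi m x -> jacobi m h ->
  jadd m (jadd m x h) (jneg h) = x.
Proof.
intros Hm Hx Hh. rewrite jadd_assoc, jadd_neg, jadd_zero; auto using jacobi_neg.
Qed.

Lemma cn_double m h : 0 < m < 1 -> jacobi m h ->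
  cn (jadd m h h) * (1 - m * (sn h ^ 2) ^ 2) = 1 - 2 * sn h ^ 2 + m * (sn h ^ 2) ^ 2.
Proof.
intros Hm Hh. pose proof (jden_pos m h h Hm Hh Hh) as HD.
destruct Hh as (ch & dh & _). unfold jadd, jden in *; simpl cn.
field_simplify_eq; [|lra]. ring [ch dh].
Qed.

(** Halving allows any two contact parameters to be written as g - h and g + h. *)
Lemma jadd_halve m t : 0 < m < 1 -> jacobi m t ->
  exists h, jacobi m h /\ jadd m h h = t.
Proof.
intros Hm Ht. pose proof (jacobi_sn2_le1 _ _ Ht) as Bt.
pose proof Ht as (ct & dt & pt0).
(* [sn^2 (t/2) = (1 - cn t) / (1 + dn t)]; the sign [e] of [cn (t/2)] is chosen to match [sn t]. *)
set (A := (1 - cn t) / (1 + dn t)).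
(* The lower bound, from cn^2 <= dn^2 (as m < 1), is what makes A <= 1. *)
assert (Bc : - dn t <= cn t <= 1).
{ split; [|nra].
  apply Ropp_le_cancel. rewrite Ropp_involutive.
  assert (cn t ^ 2 <= dn t ^ 2) by nra. nra. }
assert (HA : 0 <= A <= 1).
{ unfold A. split.
  - apply Rmult_le_pos; [lra|]. apply Rlt_le, Rinv_0_lt_compat. lra.
  - apply Rmult_le_reg_r with (1 + dn t); [lra|]. unfold Rdiv.
    rewrite Rmult_assoc, Rinv_l; lra. }
assert (HAe : A * (1 + dn t) = 1 - cn t) by (unfold A; field; lra).
set (e := if Rle_dec 0 (sn t) then 1 else -1).
assert (He : e ^ 2 = 1) by (unfold e; destruct Rle_dec; ring).
set (h := J (sqrt A) (e * sqrt (1 - A)) (sqrt (1 - m * A))).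
assert (s2 : sn h ^ 2 = A) by (simpl sn; rewrite pow2_sqrt; lra).
assert (HmA : 0 < 1 - m * A) by nra.
assert (Hh : jacobi m h).
{ repeat split; rewrite ?s2; simpl cn; simpl dn.
  - rewrite Rpow_mult_distr, He, pow2_sqrt; lra.
  - rewrite pow2_sqrt; lra.
  - apply sqrt_lt_R0; lra. }
exists h; split; auto.
pose proof (jadd_closed m h h Hm Hh Hh) as (C2 & _ & _).
assert (Hc : cn (jadd m h h) = cn t).
{ pose proof (cn_double m h Hm Hh) as H2. rewrite s2 in H2.
  assert (HA2 : 0 <= A ^ 2 <= 1) by nra.
  apply Rmult_eq_reg_r with (1 - m * A ^ 2); [|nra].
  rewrite H2.
  (* Multiplied by 1 + dn t, this is m sn^2 t = 1 - dn^2 t times 1 - cn t. *)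
  assert (m * A ^ 2 * (1 + cn t) * (1 + dn t) = (1 - cn t) * (1 - dn t)).
  { apply Rmult_eq_reg_r with (1 + dn t); [|lra].
    replace (m * A ^ 2 * (1 + cn t) * (1 + dn t) * (1 + dn t))
      with (m * (1 + cn t) * (A * (1 + dn t)) ^ 2) by ring.
    rewrite HAe. ring [ct dt]. }
  apply Rmult_eq_reg_r with (1 + dn t); [|lra].
  nra. }
apply (jacobi_ext m); auto using jadd_closed.
assert (Hs2 : Rsqr (sn (jadd m h h)) = Rsqr (sn t)).
{ rewrite !Rsqr_pow2. rewrite Hc in C2. lra. }
pose proof (jden_pos m h h Hm Hh Hh) as HD.
assert (Hp : 0 <= sqrt A * sqrt (1 - A) * sqrt (1 - m * A) * / jden m h h).
{ repeat apply Rmult_le_pos; try apply sqrt_pos. apply Rlt_le, Rinv_0_lt_compat; auto. }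
assert (Hsn : sn (jadd m h h) =
  e * (2 * (sqrt A * sqrt (1 - A) * sqrt (1 - m * A) * / jden m h h))).
{ unfold jadd; simpl sn; unfold Rdiv. generalize (/ jden m h h); intros r; simpl. ring. }
(* In the opposite case the choice of e leaves only sn t = 0, where both signs agree. *)
destruct (Rsqr_eq _ _ Hs2) as [|Hop]; auto.
rewrite Hop in *. unfold e in Hsn. destruct Rle_dec; lra.
Qed.

Fixpoint jmul (m : R) (n : nat) (x : jac) : jac :=
  match n with O => jzero | S n' => jadd m (jmul m n' x) x end.

Lemma jacobi_mul m n x : 0 < m < 1 -> jacobi m x -> jacobi m (jmul m n x).
Proof. intros Hm Hx; induction n; simpl; auto using jacobi_zero, jadd_closed. Qed.

Lemma jmul_neg m n x : jmul m n (jneg x) = jneg (jmul m n x).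
Proof.
induction n; simpl.
- apply jac_eq; simpl; ring.
- rewrite IHn, jneg_add. reflexivity.
Qed.

Lemma lattice_add m w (q : Z -> jac) : 0 < m < 1 -> jacobi m w ->
  (forall n, jacobi m (q n)) -> (forall n, q (n + 1)%Z = jadd m (q n) w) ->
  forall k n, q (n + Z.of_nat k)%Z = jadd m (q n) (jmul m k w).
Proof.
intros Hm Hw Hq Hs k; induction k; intros n.
- simpl. rewrite Z.add_0_r, jadd_zero. reflexivity.
- replace (n + Z.of_nat (S k))%Z with (n + Z.of_nat k + 1)%Z by lia.
  rewrite Hs, IHk; simpl. apply jadd_assoc; auto using jacobi_mul.
Qed.

Lemma lattice_sub m w (q : Z -> jac) : 0 < m < 1 -> jacobi m w ->
  (forall n, jacobi m (q n)) -> (forall n, q (n + 1)%Z = jadd m (q n) w) ->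
  forall k n, q (n - Z.of_nat k)%Z = jadd m (q n) (jneg (jmul m k w)).
Proof.
intros Hm Hw Hq Hs k n.
replace (q n) with (q (n - Z.of_nat k + Z.of_nat k)%Z) by (f_equal; lia).
rewrite (lattice_add m w) by auto. rewrite jadd_negK; auto using jacobi_mul.
Qed.

(** * Tangent lines of the caustic *)

Definition modulus (a b : R) : R := 1 - b ^ 2 / a ^ 2.

Lemma modulus_bounds a b : 0 < b -> b < a -> 0 < modulus a b < 1.
Proof.
intros Hb Ha. unfold modulus.
assert (0 < b ^ 2 / a ^ 2) by (apply Rdiv_lt_0_compat; nra).
assert (b ^ 2 / a ^ 2 < 1).
{ apply Rmult_lt_reg_r with (a ^ 2); [nra|]. unfold Rdiv.
  rewrite Rmult_assoc, Rinv_l by nra. nra. }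
lra.
Qed.

Lemma modulus_mul a b : 0 < a -> a ^ 2 * modulus a b = a ^ 2 - b ^ 2.
Proof. intros Ha. unfold modulus. field. lra. Qed.

Definition cpt (a b : R) (g : jac) : pt := (a * sn g, b * cn g).

Definition on_tangent (a b : R) (g : jac) (X : pt) : Prop :=
  fst X * sn g / a + snd X * cn g / b = 1.

Definition tangent_line (a b : R) (g : jac) : hvec := HV (sn g / a) (cn g / b) (-1).

Definition jac_of (a b : R) (Q : pt) : jac :=
  J (fst Q / a) (snd Q / b) (sqrt (1 - modulus a b * (fst Q / a) ^ 2)).

Lemma cpt_jac_of a b Q : 0 < b -> b < a -> cpt a b (jac_of a b Q) = Q.
Proof.
intros Hb Ha. destruct Q as [x y]; unfold cpt, jac_of; simpl.
f_equal; field; lra.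
Qed.

Lemma jacobi_jac_of a b Q : 0 < b -> b < a -> on_conic a b 0 Q ->
  jacobi (modulus a b) (jac_of a b Q).
Proof.
intros Hb Ha HQ. pose proof (modulus_bounds a b Hb Ha) as Hm.
unfold on_conic in HQ.
assert (Hc : (snd Q / b) ^ 2 = 1 - (fst Q / a) ^ 2).
{ rewrite <- HQ. field. lra. }
assert (0 < 1 - modulus a b * (fst Q / a) ^ 2).
{ pose proof (pow2_ge_0 (snd Q / b)). nra. }
repeat split; simpl sn; simpl cn; simpl dn; auto.
- apply pow2_sqrt; lra.
- apply sqrt_lt_R0; auto.
Qed.

Lemma touches_tangent a b A B g : 0 < a -> 0 < b ->
  touches a b A B (cpt a b g) -> on_tangent a b g A /\ on_tangent a b g B.
Proof.
intros Ha Hb (_ & HA & HB). unfold on_tangent, cpt in *; simpl fst in *; simpl snd in *.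
split; [rewrite <- HA | rewrite <- HB]; field; lra.
Qed.

Lemma tangent_touches a b m A B g : 0 < a -> 0 < b -> jacobi m g ->
  on_tangent a b g A -> on_tangent a b g B -> touches a b A B (cpt a b g).
Proof.
intros Ha Hb (Hg & _) HA HB. unfold touches, on_conic, on_tangent, cpt in *; simpl fst in *; simpl snd in *.
repeat split; [|rewrite <- HA | rewrite <- HB]; try (field; lra).
field_simplify_eq; [|lra]. ring [Hg].
Qed.

(** The factor is minus the determinant of A and B; if it vanished, [Ex] and [Ey] would give A =
    B. *)
Lemma line_of_tangent a b g A B : 0 < a -> 0 < b -> A <> B ->
  on_tangent a b g A -> on_tangent a b g B ->
  exists l, l <> 0 /\ line_of A B = hscale l (tangent_line a b g).
Proof.
intros Ha Hb HAB HA HB. destruct A as [x y], B as [x' y'].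
unfold on_tangent in *; simpl fst in *; simpl snd in *.
set (p := sn g / a). set (r := cn g / b).
assert (H1 : x * p + y * r = 1) by (rewrite <- HA; unfold p, r; field; lra).
assert (H2 : x' * p + y' * r = 1) by (rewrite <- HB; unfold p, r; field; lra).
assert (Ex : y - y' = - (x * y' - y * x') * p) by
 (replace (y - y') with (y * (x' * p + y' * r) - y' * (x * p + y * r)) by (rewrite H1, H2; ring); ring).
assert (Ey : x' - x = - (x * y' - y * x') * r) by
 (replace (x' - x) with (x' * (x * p + y * r) - x * (x' * p + y' * r)) by (rewrite H1, H2; ring); ring).
exists (- (x * y' - y * x')). split.
- intros H0. apply HAB. rewrite H0 in *. f_equal; lra.
- unfold line_of, cross, hom, hscale, tangent_line; simpl. fold p r.
  f_equal; [rewrite <- Ex | rewrite <- Ey |]; ring.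
Qed.

(** The third coordinate -1 normalizes [tangent_line], so proportional tangents have the same sn and
    cn. *)
Lemma tangent_unique a b g g' A B : 0 < a -> 0 < b -> A <> B ->
  on_tangent a b g A -> on_tangent a b g B ->
  on_tangent a b g' A -> on_tangent a b g' B -> sn g = sn g' /\ cn g = cn g'.
Proof.
intros Ha Hb HAB HA HB HA' HB'.
destruct (line_of_tangent a b g A B) as (l & Hl & E); auto.
destruct (line_of_tangent a b g' A B) as (l' & Hl' & E'); auto.
rewrite E in E'. unfold hscale, tangent_line in E'; simpl in E'.
injection E' as E1 E2 E3.
assert (l' = l) by lra. subst l'.
apply Rmult_eq_reg_l in E1, E2; auto.
split; [apply Rmult_eq_reg_r with (/ a) | apply Rmult_eq_reg_r with (/ b)]; auto;
  apply Rinv_neq_0_compat; lra.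
Qed.

Lemma on_line_tangent a b g A B X : 0 < a -> 0 < b -> A <> B ->
  on_tangent a b g A -> on_tangent a b g B ->
  (on_line A B X <-> on_tangent a b g X).
Proof.
intros Ha Hb HAB HA HB.
destruct (line_of_tangent a b g A B) as (l & Hl & E); auto.
unfold line_of, cross, hom, hscale, tangent_line in E; simpl in E.
injection E as E1 E2 E3. unfold on_line, on_tangent.
assert (H : (fst B - fst A) * (snd X - snd A) - (snd B - snd A) * (fst X - fst A)
  = l * (fst X * sn g / a + snd X * cn g / b - 1)).
{ transitivity (fst X * (l * (sn g / a)) + snd X * (l * (cn g / b)) + l * -1).
  - rewrite <- E1, <- E2, <- E3. ring.
  - field; lra. }
rewrite H. split; intros H0.
- apply Rmult_integral in H0 as [|]; lra.
- rewrite H0. ring.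
Qed.

(** * Poles of chords and halved differences *)

(* See [meet_tangents]: homogeneous coordinates of the pole of the chord from [g - h] to [g + h]. *)
Definition chord_pole (a b : R) (g h : jac) : hvec :=
  HV (a * sn g * dn h) (b * cn g) (cn h).

(** The scalar between the cross product of two tangents and the pole. On Jacobi triples it vanishes
    only with sn h, when g - h and g + h coincide. *)
Definition pole_factor (m a b : R) (g h : jac) : R :=
  - 2 * sn h * dn g / (jden m g h * a * b).

(** g - h and g + h share their denominator, which is even in sn h; clearing it leaves polynomial
    identities. *)
Lemma meet_tangents m a b g h : 0 < m < 1 -> 0 < a -> 0 < b ->
  jacobi m g -> jacobi m h ->
  meet (tangent_line a b (jadd m g (jneg h))) (tangent_line a b (jadd m g h)) =
  hscale (pole_factor m a b g h) (chord_pole a b g h).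
Proof.
intros Hm Ha Hb Hg Hh. pose proof (jden_pos m g h Hm Hg Hh) as HD.
destruct Hg as (cg & dg & _), Hh as (ch & dh & _).
unfold meet, cross, tangent_line, hscale, chord_pole, pole_factor, jadd, jneg.
simpl sn; simpl cn; simpl dn; simpl hx; simpl hy; simpl hz.
replace (jden m g (J (- sn h) (cn h) (dn h))) with (jden m g h)
  by (unfold jden; simpl; ring).
unfold jden in *.
f_equal; field_simplify_eq; try (repeat split; lra); ring [cg dg ch dh].
Qed.

Lemma pole_factor_neq0 m a b g h : 0 < m < 1 -> 0 < a -> 0 < b ->
  jacobi m g -> jacobi m h -> sn h <> 0 -> pole_factor m a b g h <> 0.
Proof.
intros Hm Ha Hb Hg Hh Hs. pose proof (jden_pos m g h Hm Hg Hh) as HD.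
destruct Hg as (_ & _ & dg). unfold pole_factor, Rdiv.
repeat apply Rmult_integral_contrapositive_currified; try lra.
apply Rinv_neq_0_compat. repeat apply Rmult_integral_contrapositive_currified; lra.
Qed.

(** Cramer's rule for the two tangent equations. Since cn h is not divided out, the existence of the
    affine point X can later be used to show cn h <> 0. *)
Lemma tangent_coords m a b g h X : 0 < m < 1 -> 0 < a -> 0 < b ->
  jacobi m g -> jacobi m h -> sn h <> 0 ->
  on_tangent a b (jadd m g (jneg h)) X -> on_tangent a b (jadd m g h) X ->
  cn h * fst X = a * sn g * dn h /\ cn h * snd X = b * cn g.
Proof.
intros Hm Ha Hb Hg Hh Hs H1 H2.
pose proof (pole_factor_neq0 m a b g h Hm Ha Hb Hg Hh Hs) as HK.
pose proof (meet_tangents m a b g h Hm Ha Hb Hg Hh) as HM.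
pose proof (f_equal hx HM) as E1; pose proof (f_equal hy HM) as E2;
pose proof (f_equal hz HM) as E3; clear HM.
cbn [meet cross hscale chord_pole tangent_line hx hy hz] in E1, E2, E3.
unfold on_tangent in *.
set (p1 := sn (jadd m g (jneg h)) / a) in *. set (p2 := sn (jadd m g h) / a) in *.
set (r1 := cn (jadd m g (jneg h)) / b) in *. set (r2 := cn (jadd m g h) / b) in *.
set (K := pole_factor m a b g h) in *.
assert (F1 : fst X * p1 + snd X * r1 = 1) by (rewrite <- H1; unfold p1, r1, Rdiv; ring).
assert (F2 : fst X * p2 + snd X * r2 = 1) by (rewrite <- H2; unfold p2, r2, Rdiv; ring).
split; apply Rmult_eq_reg_l with K; auto.
- rewrite <- E1.
  replace (K * (cn h * fst X)) with ((K * cn h) * fst X) by ring. rewrite <- E3.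
  replace ((p1 * r2 - r1 * p2) * fst X)
    with (r2 * (fst X * p1 + snd X * r1) - r1 * (fst X * p2 + snd X * r2)) by ring.
  rewrite F1, F2. ring.
- rewrite <- E2.
  replace (K * (cn h * snd X)) with ((K * cn h) * snd X) by ring. rewrite <- E3.
  replace ((p1 * r2 - r1 * p2) * snd X)
    with (p1 * (fst X * p2 + snd X * r2) - p2 * (fst X * p1 + snd X * r1)) by ring.
  rewrite F1, F2. ring.
Qed.

(** h is half of g2 - g1, and g = g1 + h. *)
Lemma jacobi_bisect m g1 g2 : 0 < m < 1 -> jacobi m g1 -> jacobi m g2 ->
  exists g h, jacobi m g /\ jacobi m h /\
    g1 = jadd m g (jneg h) /\ g2 = jadd m g h /\ g2 = jadd m g1 (jadd m h h).
Proof.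
intros Hm H1 H2.
destruct (jadd_halve m (jadd m g2 (jneg g1))) as (h & Hh & E);
  auto using jadd_closed, jacobi_neg.
assert (E2 : g2 = jadd m g1 (jadd m h h)).
{ rewrite E, jadd_comm.
  replace g1 with (jneg (jneg g1)) at 2 by apply jneg_neg.
  rewrite jadd_negK; auto using jacobi_neg. }
exists (jadd m g1 h), h.
refine (conj _ (conj Hh (conj _ (conj _ E2)))); auto using jadd_closed.
- rewrite jadd_negK; auto.
- rewrite jadd_assoc; auto.
Qed.

Lemma half_difference_neq0_or_eq m g h : sn h <> 0 \/ jadd m g (jneg h) = jadd m g h.
Proof.
destruct (Req_dec (sn h) 0) as [H|H]; auto. right. f_equal.
apply jac_eq; simpl; auto. lra.
Qed.

(** * Confocal ellipses and the tangents from their points *)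

Lemma exists_half_step m b k : 0 < m < 1 -> 0 < b -> 0 < k ->
  exists v, jacobi m v /\ sn v <> 0 /\ k * cn v ^ 2 = b ^ 2 * sn v ^ 2.
Proof.
intros Hm Hb Hk.
assert (Hd : 0 < b ^ 2 + k) by nra.
(* A is the value of sn^2 v that solves k (1 - A) = b^2 A. *)
set (A := k / (b ^ 2 + k)).
assert (HA : 0 < A) by (apply Rdiv_lt_0_compat; auto).
assert (HB : 1 - A = b ^ 2 / (b ^ 2 + k)) by (unfold A; field; lra).
assert (HB0 : 0 < 1 - A) by (rewrite HB; apply Rdiv_lt_0_compat; nra).
assert (HC : 0 < 1 - m * A) by nra.
exists (J (sqrt A) (sqrt (1 - A)) (sqrt (1 - m * A))).
unfold jacobi; simpl sn; simpl cn; simpl dn.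
rewrite !pow2_sqrt by lra. split; [|split].
- repeat split; try lra. apply sqrt_lt_R0; auto.
- pose proof (sqrt_lt_R0 _ HA). lra.
- rewrite HB. unfold A. field. lra.
Qed.

(** For this k, a^2 + k = a^2 dn^2 h / cn^2 h and b^2 + k = b^2 / cn^2 h, so the equation reduces to
    sn^2 g + cn^2 g = 1. *)
Lemma conic_through_poles a b h g l : 0 < b -> b < a ->
  jacobi (modulus a b) g -> jacobi (modulus a b) h -> cn h <> 0 ->
  on_member a b (Member (b ^ 2 * sn h ^ 2 / cn h ^ 2)) (hscale l (chord_pole a b g h)).
Proof.
intros Hb Ha (cg & _) (ch & dh & ph) Hc. cbn [on_member hscale chord_pole hx hy hz].
assert (Hm : a ^ 2 * modulus a b = a ^ 2 - b ^ 2) by (apply modulus_mul; lra).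
assert (Ka : a ^ 2 + b ^ 2 * sn h ^ 2 / cn h ^ 2 = a ^ 2 * dn h ^ 2 / cn h ^ 2).
{ field_simplify_eq; auto. rewrite ch, dh.
  transitivity (a ^ 2 - (a ^ 2 * modulus a b) * sn h ^ 2); [rewrite Hm |]; ring. }
assert (Kb : b ^ 2 + b ^ 2 * sn h ^ 2 / cn h ^ 2 = b ^ 2 / cn h ^ 2).
{ field_simplify_eq; auto. rewrite ch. ring. }
rewrite Ka, Kb. field_simplify_eq; [|lra]. rewrite cg. ring.
Qed.

(** The difference of the equations is k - k' times a sum of nonnegative terms; that sum vanishes
    only at the centre, which lies on no ellipse. *)
Lemma nested_ellipses a b k k' X : 0 < b -> b < a -> 0 <= k -> 0 <= k' ->
  on_conic a b k X -> on_conic a b k' X -> k = k'.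
Proof.
intros Hb Ha Hk Hk' H H'. unfold on_conic in *.
set (x := fst X ^ 2) in *. set (y := snd X ^ 2) in *.
assert (Hx : 0 <= x) by apply pow2_ge_0. assert (Hy : 0 <= y) by apply pow2_ge_0.
assert (0 < a ^ 2 + k) by nra. assert (0 < a ^ 2 + k') by nra.
assert (0 < b ^ 2 + k) by nra. assert (0 < b ^ 2 + k') by nra.
assert (E : (k - k') * (x / ((a ^ 2 + k) * (a ^ 2 + k')) + y / ((b ^ 2 + k) * (b ^ 2 + k'))) = 0).
{ transitivity ((x / (a ^ 2 + k') + y / (b ^ 2 + k')) - (x / (a ^ 2 + k) + y / (b ^ 2 + k))).
  - field. repeat split; lra.
  - lra. }
assert (Pa : 0 < (a ^ 2 + k) * (a ^ 2 + k')) by (apply Rmult_lt_0_compat; auto).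
assert (Pb : 0 < (b ^ 2 + k) * (b ^ 2 + k')) by (apply Rmult_lt_0_compat; auto).
apply Rmult_integral in E as [E|E]; [lra|exfalso].
assert (0 <= x / ((a ^ 2 + k) * (a ^ 2 + k')))
  by (apply Rmult_le_pos; auto; apply Rlt_le, Rinv_0_lt_compat; auto).
assert (0 <= y / ((b ^ 2 + k) * (b ^ 2 + k')))
  by (apply Rmult_le_pos; auto; apply Rlt_le, Rinv_0_lt_compat; auto).
assert (Zx : x = 0).
{ replace x with (x / ((a ^ 2 + k) * (a ^ 2 + k')) * ((a ^ 2 + k) * (a ^ 2 + k'))) by (field; repeat split; lra).
  replace (x / ((a ^ 2 + k) * (a ^ 2 + k'))) with 0 by lra. ring. }
assert (Zy : y = 0).
{ replace y with (y / ((b ^ 2 + k) * (b ^ 2 + k')) * ((b ^ 2 + k) * (b ^ 2 + k'))) by (field; repeat split; lra).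
  replace (y / ((b ^ 2 + k) * (b ^ 2 + k'))) with 0 by lra. ring. }
rewrite Zx, Zy in H. unfold Rdiv in H. lra.
Qed.

Lemma sq_eq_cases x y : x ^ 2 = y ^ 2 -> x = y \/ x = - y.
Proof. rewrite <- !Rsqr_pow2. apply Rsqr_eq. Qed.

(* By [conic_through_poles] the half difference h of g1 and g2 determines the confocal ellipse
   through X; nested confocal ellipses are disjoint, so sn^2 h = sn^2 v and cn^2 h = cn^2 v. *)
Lemma tangents_from_ellipse a b k v g1 g2 X : 0 < b -> b < a -> 0 < k ->
  let m := modulus a b in
  jacobi m v -> k * cn v ^ 2 = b ^ 2 * sn v ^ 2 ->
  jacobi m g1 -> jacobi m g2 -> g1 <> g2 ->
  on_tangent a b g1 X -> on_tangent a b g2 X -> on_conic a b k X ->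
  exists w, (w = v \/ w = jneg v) /\ g2 = jadd m g1 (jadd m w w).
Proof.
intros Hb Ha Hk m Hv Hkv H1 H2 H12 T1 T2 HX.
assert (Hm : 0 < m < 1) by (apply modulus_bounds; auto).
assert (Ha0 : 0 < a) by lra.
destruct (jacobi_bisect m g1 g2) as (g & h & Hg & Hh & E1 & E2 & E3); auto.
destruct (half_difference_neq0_or_eq m g h) as [Hs | Hs]; [|congruence].
rewrite E1 in T1. rewrite E2 in T2.
destruct (tangent_coords m a b g h X) as [Ex Ey]; auto.
(* cn h = 0 would force sn g = cn g = 0. *)
assert (Hc : cn h <> 0).
{ intros Hc. rewrite Hc in Ex, Ey. destruct Hg as (cg & _), Hh as (ch & dh & ph).
  assert (sn g * dn h = 0) by (apply Rmult_eq_reg_l with a; lra).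
  assert (sn g = 0) by (apply Rmult_eq_reg_r with (dn h); lra).
  assert (cn g = 0) by (apply Rmult_eq_reg_l with b; lra).
  nra. }
assert (Hk' : on_conic a b (b ^ 2 * sn h ^ 2 / cn h ^ 2) X).
{ pose proof (conic_through_poles a b h g (/ cn h) Hb Ha Hg Hh Hc) as C.
  unfold on_conic. cbn [on_member] in C. unfold hscale, chord_pole in C.
  cbn [hx hy hz] in C.
  replace (/ cn h * (a * sn g * dn h)) with (fst X) in C by (rewrite <- Ex; field; auto).
  replace (/ cn h * (b * cn g)) with (snd X) in C by (rewrite <- Ey; field; auto).
  rewrite C. field; auto. }
assert (Ek : k = b ^ 2 * sn h ^ 2 / cn h ^ 2).
{ apply (nested_ellipses a b k _ X); auto; try lra.
  apply Rmult_le_pos; [nra|]. apply Rlt_le, Rinv_0_lt_compat.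
  pose proof (pow2_ge_0 (cn h)). pose proof (pow_nonzero _ 2 Hc). lra. }
assert (Ekh : k * cn h ^ 2 = b ^ 2 * sn h ^ 2) by (rewrite Ek; field; auto).
destruct Hv as (cv & dv & pv), Hh as (ch & dh & ph).
assert (Es : sn h ^ 2 = sn v ^ 2).
{ apply Rmult_eq_reg_l with (b ^ 2 + k); [|nra]. rewrite ch in Ekh; rewrite cv in Hkv. lra. }
assert (Ec : cn h ^ 2 = cn v ^ 2) by lra.
assert (Ed : dn h = dn v).
{ apply Rsqr_inj; try lra. rewrite !Rsqr_pow2, dh, dv, Es. ring. }
(* Doubling sees only sn^2, cn^2, dn and the product sn cn. Flipping both signs changes nothing, so
   the four sign cases of h yield only v and -v. *)
assert (D : forall w, sn h ^ 2 = sn w ^ 2 -> dn h = dn w -> sn h * cn h = sn w * cn w ->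
   cn h ^ 2 = cn w ^ 2 -> jadd m h h = jadd m w w).
{ intros w Ws Wd Wsc Wc. unfold jadd, jden. rewrite Ws, Wd.
  f_equal; f_equal; try (rewrite Wsc; ring); [ | ].
  - replace (cn h * cn h - sn h * sn h * dn w * dn w) with (cn h ^ 2 - sn h ^ 2 * dn w ^ 2) by ring.
    rewrite Ws, Wc. ring.
  - replace (m * sn h * sn h * cn h * cn h) with (m * (sn h * cn h) ^ 2) by ring.
    rewrite Wsc. ring. }
rewrite E3.
destruct (sq_eq_cases _ _ Ec) as [Ec' | Ec'], (sq_eq_cases _ _ Es) as [Es' | Es'];
  [ exists v | exists (jneg v) | exists (jneg v) | exists v ]; (split; [auto|]);
  f_equal; apply D; simpl; rewrite ?Ec', ?Es'; auto; ring.
Qed.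

(** * Billiards as arithmetic progressions *)

(** Each step is 2v or -2v by [tangents_from_ellipse]. A change of sign would give r (i + 2) = r i,
    which [R2] excludes. *)
Lemma billiard_progression a b k v (P : Z -> pt) (r : Z -> jac) :
  0 < b -> b < a -> 0 < k -> let m := modulus a b in
  jacobi m v -> k * cn v ^ 2 = b ^ 2 * sn v ^ 2 ->
  (forall i, jacobi m (r i)) ->
  (forall i, on_tangent a b (r i) (P i)) ->
  (forall i, on_tangent a b (r i) (P (i + 1)%Z)) ->
  billiard a b k P ->
  exists w, (w = v \/ w = jneg v) /\
    forall i, r (i + 1)%Z = jadd m (r i) (jadd m w w).
Proof.
intros Hb Ha Hk m Hv Hkv Hr T1 T2 HP.
assert (Hm : 0 < m < 1) by (apply modulus_bounds; auto).
assert (Ha0 : 0 < a) by lra.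
assert (Hne : forall i, P i <> P (i + 1)%Z)
  by (intros i E; destruct (HP i) as (_ & N & _); auto).
assert (R1 : forall i, r i <> r (i + 1)%Z).
{ intros i E. destruct (HP (i + 1)%Z) as (_ & _ & _ & H). apply H.
  replace (i + 1 - 1)%Z with i by lia. intros X.
  rewrite (on_line_tangent a b (r i)), (on_line_tangent a b (r (i + 1)%Z)); auto.
  rewrite E; tauto. }
(* Otherwise the tangents at r i and r (i + 1) share the distinct points P (i + 1) and P (i + 2). *)
assert (R2 : forall i, r (i + 1 + 1)%Z <> r i).
{ intros i E. apply (R1 i).
  assert (H : sn (r i) = sn (r (i + 1)%Z) /\ cn (r i) = cn (r (i + 1)%Z)).
  { apply (tangent_unique a b _ _ (P (i + 1)%Z) (P (i + 1 + 1)%Z)); auto.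
    rewrite <- E. apply T1. }
  apply (jacobi_ext m); auto; apply H. }
assert (St : forall i, exists w, (w = v \/ w = jneg v) /\
    r (i + 1)%Z = jadd m (r i) (jadd m w w)).
{ intros i. apply (tangents_from_ellipse a b k v _ _ (P (i + 1)%Z)); auto. apply HP. }
assert (Back : forall w i, jacobi m w -> r (i + 1)%Z = jadd m (r i) (jadd m (jneg w) (jneg w)) ->
   r (i + 1 + 1)%Z = jadd m (r (i + 1)%Z) (jadd m w w) -> False).
{ intros w i Hw E1 E2. apply (R2 i). rewrite E2, E1.
  rewrite <- jneg_add. rewrite <- (jneg_neg (jadd m w w)) at 2.
  apply jadd_negK; auto using jacobi_neg, jadd_closed. }
assert (Hvn : jacobi m (jneg v)) by (apply jacobi_neg; auto).
(* The sign at index 0 fixes w; induction in both directions propagates it. *)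
destruct (St 0%Z) as (w & Hw & E0). exists w. split; auto.
assert (HJw : jacobi m w) by (destruct Hw; subst; auto).
assert (Alt : forall w', w' = v \/ w' = jneg v -> w' = w \/ w' = jneg w).
{ intros w' [-> | ->]; destruct Hw as [-> | ->]; rewrite ?jneg_neg; auto. }
apply Z.bi_induction; auto.
- intros x y ->. tauto.
- intros i. rewrite <- Z.add_1_r. split; intros E.
  + destruct (St (i + 1)%Z) as (w' & Hw' & E').
    destruct (Alt w' Hw') as [-> | ->]; auto.
    exfalso. apply (Back (jneg w) i); auto using jacobi_neg. rewrite jneg_neg; auto.
  + destruct (St i) as (w' & Hw' & E').
    destruct (Alt w' Hw') as [-> | ->]; auto.
    exfalso. apply (Back w i); auto.
Qed.

(** The odd places, filled with r i + w, will serve the vertices P_i and the points S_i^(j) with j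
    even. *)
Lemma half_lattice m w (r : Z -> jac) : 0 < m < 1 -> jacobi m w ->
  (forall i, jacobi m (r i)) -> (forall i, r (i + 1)%Z = jadd m (r i) (jadd m w w)) ->
  exists q : Z -> jac, (forall n, jacobi m (q n)) /\
    (forall n, q (n + 1)%Z = jadd m (q n) w) /\ forall i, q (2 * i)%Z = r i.
Proof.
intros Hm Hw Hr Hs.
(* Division on Z rounds down, so the formula also fits negative n. *)
set (q := fun n => if Z.even n then r (n / 2)%Z else jadd m (r (n / 2)%Z) w).
assert (Q0 : forall i, q (2 * i)%Z = r i).
{ intros i. unfold q. rewrite Z.even_mul. simpl orb.
  rewrite Z.mul_comm, Z.div_mul by lia. reflexivity. }
assert (Q1 : forall i, q (2 * i + 1)%Z = jadd m (r i) w).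
{ intros i. unfold q.
  replace (Z.even (2 * i + 1)) with false by (rewrite Z.even_add, Z.even_mul; reflexivity).
  replace ((2 * i + 1) / 2)%Z with i by (apply Z.div_unique with 1%Z; lia). reflexivity. }
assert (Hcase : forall n, exists i, n = (2 * i)%Z \/ n = (2 * i + 1)%Z).
{ intros n. destruct (Z.Even_or_Odd n) as [[i E] | [i E]]; exists i; auto. }
exists q. split; [|split]; auto.
- intros n. destruct (Hcase n) as (i & [-> | ->]); rewrite ?Q0, ?Q1; auto using jadd_closed.
- intros n. destruct (Hcase n) as (i & [-> | ->]).
  + rewrite Q0, Q1. reflexivity.
  + replace (2 * i + 1 + 1)%Z with (2 * (i + 1))%Z by lia.
    rewrite Q0, Q1, Hs, jadd_assoc; auto.
Qed.

(** * Confocal hyperbolas through poles *)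

(** Here a^2 + k = (a^2 - b^2) sn^2 g and b^2 + k = -(a^2 - b^2) cn^2 g; where one of them vanishes,
    the hyperbola degenerates to an axis. *)
Definition confocal_hyperbola (a b : R) (g : jac) : confocal :=
  if Req_dec_T (sn g) 0 then YAxis else
  if Req_dec_T (cn g) 0 then XAxis else Member (- a ^ 2 + (a ^ 2 - b ^ 2) * sn g ^ 2).

Lemma confocal_hyperbola_kind a b g : 0 < b -> b < a -> jacobi (modulus a b) g ->
  valid_member a b (confocal_hyperbola a b g) /\
  is_hyperbola_or_axis a b (confocal_hyperbola a b g).
Proof.
intros Hb Ha (cg & _). unfold confocal_hyperbola.
destruct Req_dec_T as [|Hs]; [simpl; auto|]. destruct Req_dec_T as [|Hc]; [simpl; auto|].
assert (0 < sn g ^ 2) by (pose proof (pow2_ge_0 (sn g)); pose proof (pow_nonzero _ 2 Hs); lra).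
assert (0 < cn g ^ 2) by (pose proof (pow2_ge_0 (cn g)); pose proof (pow_nonzero _ 2 Hc); lra).
assert (0 < a ^ 2 - b ^ 2) by nra.
cbn [valid_member is_hyperbola_or_axis].
assert (- a ^ 2 < - a ^ 2 + (a ^ 2 - b ^ 2) * sn g ^ 2 < - b ^ 2) by nra.
lra.
Qed.

(** Away from the axes, g cancels and the equation becomes a^2 dn^2 h - b^2 = (a^2 - b^2) cn^2 h,
    which holds because a^2 m = a^2 - b^2. *)
Lemma hyperbola_through_poles a b g h l : 0 < b -> b < a ->
  jacobi (modulus a b) g -> jacobi (modulus a b) h ->
  on_member a b (confocal_hyperbola a b g) (hscale l (chord_pole a b g h)).
Proof.
intros Hb Ha (cg & _) (ch & dh & _). unfold confocal_hyperbola.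
assert (Hm : a ^ 2 * modulus a b = a ^ 2 - b ^ 2) by (apply modulus_mul; lra).
destruct Req_dec_T as [Hs|Hs]; [simpl; rewrite Hs; ring|].
destruct Req_dec_T as [Hc|Hc]; [simpl; rewrite Hc; ring|].
assert (0 < a ^ 2 - b ^ 2) by nra.
cbn [on_member hscale chord_pole hx hy hz].
replace (a ^ 2 + (- a ^ 2 + (a ^ 2 - b ^ 2) * sn g ^ 2)) with ((a ^ 2 - b ^ 2) * sn g ^ 2) by ring.
replace (b ^ 2 + (- a ^ 2 + (a ^ 2 - b ^ 2) * sn g ^ 2))
  with (- (a ^ 2 - b ^ 2) * cn g ^ 2) by (rewrite cg; ring).
transitivity (l ^ 2 * ((a ^ 2 * dn h ^ 2 - b ^ 2) / (a ^ 2 - b ^ 2))).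
- field. repeat split; auto; lra.
- rewrite dh. replace (a ^ 2 * (1 - modulus a b * sn h ^ 2) - b ^ 2)
    with (a ^ 2 - b ^ 2 - (a ^ 2 * modulus a b) * sn h ^ 2) by ring.
  rewrite Hm. rewrite Rpow_mult_distr, ch. field. lra.
Qed.

(** * Billiards formed by poles *)

Lemma pole_on_tangent m a b g h : 0 < m < 1 -> 0 < a -> 0 < b ->
  jacobi m g -> jacobi m h -> cn h <> 0 ->
  on_tangent a b (jadd m g h) (a * sn g * dn h / cn h, b * cn g / cn h).
Proof.
intros Hm Ha Hb Hg Hh Hc. pose proof (jden_pos m g h Hm Hg Hh) as HD.
destruct Hg as (cg & dg & _), Hh as (ch & dh & _).
unfold on_tangent, jadd, jden in *; simpl fst; simpl snd; simpl sn; simpl cn.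
field_simplify_eq; [|repeat split; lra]. ring [cg dg ch dh].
Qed.

(** Consecutive poles lie on a common tangent, since q n + h = q (n + 1) - h. *)
Lemma pole_billiard a b h (q : Z -> jac) : 0 < b -> b < a ->
  let m := modulus a b in
  jacobi m h -> sn h <> 0 -> cn h <> 0 ->
  (forall n, jacobi m (q n)) -> (forall n, q (n + 1)%Z = jadd m (q n) (jadd m h h)) ->
  billiard a b (b ^ 2 * sn h ^ 2 / cn h ^ 2)
    (fun n => (a * sn (q n) * dn h / cn h, b * cn (q n) / cn h)).
Proof.
intros Hb Ha m Hh Hs Hc Hq Hstep.
assert (Hm : 0 < m < 1) by (apply modulus_bounds; auto).
assert (Ha0 : 0 < a) by lra.
set (T := fun n => _).
assert (Hhn : jacobi m (jneg h)) by (apply jacobi_neg; auto).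
assert (T1 : forall n, on_tangent a b (jadd m (q n) h) (T n)).
{ intros n. apply pole_on_tangent; auto. }
assert (E : forall n, jadd m (q (n + 1)%Z) (jneg h) = jadd m (q n) h).
{ intros n. rewrite Hstep. rewrite <- (jadd_assoc m (q n)) by auto.
  apply jadd_negK; auto using jadd_closed. }
assert (T2 : forall n, on_tangent a b (jadd m (q n) h) (T (n + 1)%Z)).
{ intros n. rewrite <- E.
  apply (pole_on_tangent m a b (q (n + 1)%Z) (jneg h)); auto. }
assert (Hg : forall n, jacobi m (jadd m (q n) h)) by (intros; apply jadd_closed; auto).
(* Equal tangents would meet in the zero vector, but the third coordinate of the meet is
   [pole_factor] times cn h. *)
assert (Hne : forall n, jadd m (q n) h <> jadd m (q (n + 1)%Z) h).
{ intros n En.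
  pose proof (pole_factor_neq0 m a b (q (n + 1)%Z) h Hm Ha0 Hb (Hq _) Hh Hs) as HK.
  pose proof (meet_tangents m a b (q (n + 1)%Z) h Hm Ha0 Hb (Hq _) Hh) as HM.
  rewrite E, En in HM. apply (f_equal hz) in HM.
  cbn [meet cross hscale chord_pole hz] in HM.
  assert (H0 : pole_factor m a b (q (n + 1)%Z) h * cn h = 0) by (rewrite <- HM; ring).
  apply Rmult_integral in H0 as [|]; auto. }
assert (TN : forall n, T (n + 1)%Z <> T n).
{ intros n En. unfold T in En.
  pose proof (f_equal fst En) as Ex; pose proof (f_equal snd En) as Ey; simpl in Ex, Ey.
  pose proof (proj2 (proj2 Hh)) as ph.
  assert (Es : sn (q (n + 1)%Z) = sn (q n)).
  { replace (sn (q (n + 1)%Z)) with (a * sn (q (n + 1)%Z) * dn h / cn h * (cn h / (a * dn h)))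
      by (field; repeat split; lra).
    rewrite Ex. field. repeat split; lra. }
  assert (Ec : cn (q (n + 1)%Z) = cn (q n)).
  { replace (cn (q (n + 1)%Z)) with (b * cn (q (n + 1)%Z) / cn h * (cn h / b))
      by (field; repeat split; lra).
    rewrite Ey. field. repeat split; lra. }
  apply (Hne n). f_equal. apply (jacobi_ext m); auto. }
intros i. split; [|split; [|split]].
- pose proof (conic_through_poles a b h (q i) (/ cn h) Hb Ha (Hq i) Hh Hc) as C.
  cbn [on_member hscale chord_pole hx hy hz] in C. unfold on_conic, T; cbn [fst snd].
  replace (a * sn (q i) * dn h / cn h) with (/ cn h * (a * sn (q i) * dn h)) by (unfold Rdiv; ring).
  replace (b * cn (q i) / cn h) with (/ cn h * (b * cn (q i))) by (unfold Rdiv; ring).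
  rewrite C. field. auto.
- apply TN.
- exists (cpt a b (jadd m (q i) h)). apply (tangent_touches a b m); auto.
(* If two adjacent sides coincide, both tangents pass through T i and T (i + 1), hence are equal,
   against [Hne]. *)
- intros H.
  assert (Hi : (i - 1 + 1)%Z = i) by lia.
  pose proof (T2 (i - 1)%Z) as T2'. pose proof (TN (i - 1)%Z) as TN'.
  pose proof (Hne (i - 1)%Z) as Hne'. rewrite Hi in *.
  apply Hne'.
  assert (X1 : on_tangent a b (jadd m (q (i - 1)%Z) h) (T (i + 1)%Z)).
  { apply (on_line_tangent a b _ (T (i - 1)%Z) (T i)); auto.
    apply H. apply (on_line_tangent a b (jadd m (q i) h)); auto. }
  destruct (tangent_unique a b (jadd m (q (i - 1)%Z) h) (jadd m (q i) h) (T i) (T (i + 1)%Z)); auto.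
  apply (jacobi_ext m); auto.
Qed.

(** * Lattice parameters of a billiard and of its points S_i^(j) *)

(** Sides occupy the even indices, so the midpoint of any two contact parameters is again a lattice
    point. *)
Definition parametrizes (a b : R) (w : jac) (q : Z -> jac) (P : Z -> pt) : Prop :=
  let m := modulus a b in
  jacobi m w /\ (forall n, jacobi m (q n)) /\ (forall n, q (n + 1)%Z = jadd m (q n) w) /\
  forall i, P i <> P (i + 1)%Z /\
    on_tangent a b (q (2 * i)%Z) (P i) /\ on_tangent a b (q (2 * i)%Z) (P (i + 1)%Z).

Lemma billiard_parametrized a b k v (P Q : Z -> pt) : 0 < b -> b < a -> 0 < k ->
  jacobi (modulus a b) v -> k * cn v ^ 2 = b ^ 2 * sn v ^ 2 ->
  billiard a b k P -> (forall i, touches a b (P i) (P (i + 1)%Z) (Q i)) ->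
  exists w q, (w = v \/ w = jneg v) /\ parametrizes a b w q P /\
    forall i, cpt a b (q (2 * i)%Z) = Q i.
Proof.
intros Hb Ha Hk Hv Hkv HP HQ.
pose proof (modulus_bounds a b Hb Ha) as Hm.
set (r := fun i => jac_of a b (Q i)).
assert (Hr : forall i, jacobi (modulus a b) (r i))
  by (intros i; apply jacobi_jac_of; auto; apply HQ).
assert (Hc : forall i, cpt a b (r i) = Q i) by (intros i; apply cpt_jac_of; auto).
assert (HT : forall i, on_tangent a b (r i) (P i) /\ on_tangent a b (r i) (P (i + 1)%Z)).
{ intros i. apply touches_tangent; try lra. rewrite Hc. apply HQ. }
destruct (billiard_progression a b k v P r) as (w & Hw & Hs); auto;
  try (intros i; apply HT).
assert (HJ : jacobi (modulus a b) w) by (destruct Hw; subst; auto using jacobi_neg).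
destruct (half_lattice (modulus a b) w r) as (q & Hq & Hq1 & Hq2); auto.
exists w, q. split; [auto|]. split.
- refine (conj HJ (conj Hq (conj Hq1 _))). intros i. rewrite Hq2. split; [|apply HT].
  destruct (HP i) as (_ & N & _). auto.
- intros i. rewrite Hq2. apply Hc.
Qed.

(* [S_i^(j)] is the pole of the chord joining the half-step parameters
   [center i j - (j + 1)] and [center i j + (j + 1)]. *)
Definition center (i : Z) (j : nat) : Z := (2 * i - if Nat.even j then 1 else 0)%Z.

(** The sides that meet have indices 2(i - k - 1) and 2(i + k) for j = 2k, and 2(i - k) and 2(i + k)
    for j = 2k - 1: both pairs are the centre minus and plus j + 1. *)
Lemma S_pt_pole a b w q P i j : 0 < b -> b < a -> parametrizes a b w q P ->
  let g := q (center i j) in let h := jmul (modulus a b) (j + 1) w in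
  exists l, l <> 0 /\
    S_pt P i j = hscale (l * pole_factor (modulus a b) a b g h) (chord_pole a b g h).
Proof.
intros Hb Ha (Hw & Hq & Hs & HT) g h. set (m := modulus a b) in *.
pose proof (modulus_bounds a b Hb Ha) as Hm.
assert (Hh : jacobi m h) by (apply jacobi_mul; auto).
assert (Hmeet : forall n n' A B A' B', n = (center i j - Z.of_nat (j + 1))%Z ->
   n' = (center i j + Z.of_nat (j + 1))%Z ->
   A <> B -> on_tangent a b (q n) A -> on_tangent a b (q n) B ->
   A' <> B' -> on_tangent a b (q n') A' -> on_tangent a b (q n') B' ->
   exists l, l <> 0 /\ meet (line_of A B) (line_of A' B') =
     hscale (l * pole_factor m a b g h) (chord_pole a b g h)).
{ intros n n' A B A' B' -> -> NAB TA TB NAB' TA' TB'.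
  destruct (line_of_tangent a b (q (center i j - Z.of_nat (j + 1))%Z) A B) as (l & Hl & ->); auto; try lra.
  destruct (line_of_tangent a b (q (center i j + Z.of_nat (j + 1))%Z) A' B') as (l' & Hl' & ->); auto; try lra.
  rewrite (lattice_add m w), (lattice_sub m w) by auto. fold h g.
  exists (l * l'). split; [apply Rmult_integral_contrapositive_currified; auto|].
  replace (hscale (l * l' * pole_factor m a b g h) (chord_pole a b g h))
    with (hscale (l * l') (hscale (pole_factor m a b g h) (chord_pole a b g h)))
    by (unfold hscale; simpl; f_equal; ring).
  rewrite <- meet_tangents; auto; try lra; [|apply Hq].
  unfold meet, cross, hscale; cbn [hx hy hz]. f_equal; ring. }
assert (Hsym : forall n, P n <> P (n + 1)%Z /\ on_tangent a b (q (2 * n)%Z) (P n) /\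
   on_tangent a b (q (2 * n)%Z) (P (n + 1)%Z)) by exact HT.
unfold S_pt. destruct (Nat.even j) eqn:Ej.
- assert (Hj : j = (2 * (j / 2))%nat).
  { apply Nat.even_spec in Ej as [p ->]. rewrite (Nat.mul_comm 2 p), Nat.div_mul; lia. }
  set (k := Z.of_nat (j / 2)).
  assert (Hk : Z.of_nat j = (2 * k)%Z) by lia.
  destruct (Hsym (i - k - 1)%Z) as (N1 & N2 & N3).
  destruct (Hsym (i + k)%Z) as (N4 & N5 & N6).
  replace (i - k - 1 + 1)%Z with (i - k)%Z in * by lia.
  apply (Hmeet (2 * (i - k - 1))%Z (2 * (i + k))%Z); auto; unfold center; rewrite Ej; lia.
- assert (Hj : (j + 1 = 2 * ((j + 1) / 2))%nat).
  { rewrite <- Nat.negb_odd in Ej. apply Bool.negb_false_iff, Nat.odd_spec in Ej as [p ->].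
    replace (2 * p + 1 + 1)%nat with ((p + 1) * 2)%nat by lia. rewrite Nat.div_mul; lia. }
  set (k := Z.of_nat ((j + 1) / 2)).
  assert (Hk : Z.of_nat (j + 1) = (2 * k)%Z) by lia.
  destruct (Hsym (i - k)%Z) as (N1 & N2 & N3).
  destruct (Hsym (i + k)%Z) as (N4 & N5 & N6).
  apply (Hmeet (2 * (i - k))%Z (2 * (i + k))%Z); auto; unfold center; rewrite Ej; lia.
Qed.

(* When [sn h = 0] the two tangents coincide, all [S_i^(j)] vanish, and the choice of conic is
   arbitrary; when [cn h = 0] they are parallel. *)
Definition pole_conic (b : R) (h : jac) : confocal :=
  if Req_dec_T (sn h) 0 then XAxis else
  if Req_dec_T (cn h) 0 then LineInf else Member (b ^ 2 * sn h ^ 2 / cn h ^ 2).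

(** The half step of a billiard is v or -v, depending on its direction; the conic must be the same
    for both. *)
Lemma pole_conic_neg b h : pole_conic b (jneg h) = pole_conic b h.
Proof.
unfold pole_conic, jneg; cbn [sn cn].
destruct (Req_dec_T (- sn h) 0), (Req_dec_T (sn h) 0); try lra; auto.
destruct Req_dec_T; auto. do 2 f_equal. ring.
Qed.

Lemma pole_conic_valid a b h : 0 < b -> b < a -> valid_member a b (pole_conic b h).
Proof.
intros Hb Ha. unfold pole_conic.
destruct Req_dec_T; [exact I|]. destruct Req_dec_T as [|Hc]; [exact I|].
assert (0 <= b ^ 2 * sn h ^ 2 / cn h ^ 2).
{ apply Rmult_le_pos; [apply Rmult_le_pos; apply pow2_ge_0|].
  apply Rlt_le, Rinv_0_lt_compat.
  pose proof (pow2_ge_0 (cn h)). pose proof (pow_nonzero _ 2 Hc). lra. }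
cbn [valid_member]. nra.
Qed.

Theorem theorem3p6 :
  forall ac bc ke : R,
    0 < bc -> bc < ac -> 0 < ke ->
    (* (1) *)
    (forall (P Q : Z -> pt),
       billiard ac bc ke P ->
       (forall i : Z, touches ac bc (P i) (P (i + 1)%Z) (Q i)) ->
       forall i : Z,
         (exists h : confocal,
            valid_member ac bc h /\ is_hyperbola_or_axis ac bc h /\
            on_member ac bc h (hom (Q i)) /\
            forall j : nat, Nat.odd j = true -> on_member ac bc h (S_pt P i j)) /\
         (exists h : confocal,
            valid_member ac bc h /\ is_hyperbola_or_axis ac bc h /\
            on_member ac bc h (hom (P i)) /\
            forall j : nat, (1 <= j)%nat -> Nat.even j = true ->
              on_member ac bc h (S_pt P i j)))
    /\
    (* (2) *)
    (forall j : nat, (1 <= j)%nat ->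
       exists E : confocal,
         valid_member ac bc E /\
         forall (P Q : Z -> pt),
           billiard ac bc ke P ->
           (forall i : Z, touches ac bc (P i) (P (i + 1)%Z) (Q i)) ->
           (forall i : Z, on_member ac bc E (S_pt P i j)) /\
           (forall kE : R, E = Member kE -> - bc ^ 2 < kE ->
              forall i : Z, exists T : Z -> pt,
                billiard ac bc kE T /\
                forall n : Z, exists l : R, l <> 0 /\
                  S_pt P (i + n * Z.of_nat (j + 1))%Z j = hscale l (hom (T n)))).
Proof.
intros a b k Hb Ha Hk. set (m := modulus a b).
assert (Hm : 0 < m < 1) by (apply modulus_bounds; auto).
assert (Ha0 : 0 < a) by lra.
(* v is fixed before any billiard is given, whence the independence of e^(j) from the billiard. *)
destruct (exists_half_step m b k Hm Hb Hk) as (v & Hv & Hsv & Hkv).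
split.
- intros P Q HP HQ i.
  destruct (billiard_parametrized a b k v P Q) as (w & q & Hw & Hpar & HQq); auto.
  pose proof Hpar as (Jw & Jq & Hs & HT). fold m in Jw, Jq, Hs.
  assert (HS : forall i j, on_member a b (confocal_hyperbola a b (q (center i j))) (S_pt P i j)).
  { intros i' j. destruct (S_pt_pole a b w q P i' j) as (l & _ & ->); auto.
    apply hyperbola_through_poles; auto using jacobi_mul. }
  split.
  + exists (confocal_hyperbola a b (q (2 * i)%Z)).
    destruct (confocal_hyperbola_kind a b (q (2 * i)%Z)) as [H1 H2]; auto.
    split; [|split; [|split]]; auto.
    (* Q_i is the pole of the degenerate chord with h = 0. *)
    * replace (hom (Q i)) with (hscale 1 (chord_pole a b (q (2 * i)%Z) jzero)).
      -- apply hyperbola_through_poles; auto using jacobi_zero.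
      -- rewrite <- HQq. unfold hom, hscale, chord_pole, cpt; simpl. f_equal; ring.
    * intros j Hj. pose proof (HS i j) as H. unfold center in H.
      rewrite <- Nat.negb_odd, Hj in H. simpl negb in H. rewrite Z.sub_0_r in H. exact H.
  + exists (confocal_hyperbola a b (q (2 * i - 1)%Z)).
    destruct (confocal_hyperbola_kind a b (q (2 * i - 1)%Z)) as [H1 H2]; auto.
    split; [|split; [|split]]; auto.
    * assert (Hsw : sn w <> 0) by (destruct Hw as [-> | ->]; simpl; lra).
      assert (Hcw : cn w <> 0).
      { replace (cn w) with (cn v) by (destruct Hw as [-> | ->]; auto).
        intros C. rewrite C in Hkv. pose proof (pow_nonzero _ 2 Hsv).
        assert (0 < b ^ 2) by nra. pose proof (pow2_ge_0 (sn v)). nra. }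
      (* P_i is the pole with half difference w: its sides have indices 2i - 2 and 2i. *)
      destruct (tangent_coords m a b (q (2 * i - 1)%Z) w (P i)) as [E1 E2]; auto.
      { replace (q (2 * i - 1)%Z) with (jadd m (q (2 * (i - 1))%Z) w)
          by (rewrite <- Hs; f_equal; lia).
        rewrite jadd_negK; auto. replace i with (i - 1 + 1)%Z at 2 by lia. apply HT. }
      { rewrite <- Hs. replace (2 * i - 1 + 1)%Z with (2 * i)%Z by lia. apply HT. }
      replace (hom (P i)) with (hscale (/ cn w) (chord_pole a b (q (2 * i - 1)%Z) w)).
      -- apply hyperbola_through_poles; auto.
      -- unfold hom, hscale, chord_pole; cbn [hx hy hz].
         rewrite <- E1, <- E2. f_equal; field; auto.
    * intros j _ Hj. pose proof (HS i j) as H. unfold center in H. rewrite Hj in H. exact H.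
- intros j _. exists (pole_conic b (jmul m (j + 1) v)).
  split; [apply pole_conic_valid; auto|].
  intros P Q HP HQ.
  destruct (billiard_parametrized a b k v P Q) as (w & q & Hw & Hpar & _); auto.
  pose proof Hpar as (Jw & Jq & Hs & HT). fold m in Jw, Jq, Hs.
  set (h := jmul m (j + 1) w).
  assert (Jh : jacobi m h) by (apply jacobi_mul; auto).
  replace (pole_conic b (jmul m (j + 1) v)) with (pole_conic b h)
    by (unfold h; destruct Hw as [-> | ->]; rewrite ?jmul_neg, ?pole_conic_neg; auto).
  assert (HS : forall i, exists l, l <> 0 /\ S_pt P i j =
     hscale (l * pole_factor m a b (q (center i j)) h) (chord_pole a b (q (center i j)) h))
    by (intros i; apply S_pt_pole; auto).
  split.
  + intros i. destruct (HS i) as (l & _ & ->). unfold pole_conic.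
    destruct Req_dec_T as [H0|H0].
    { unfold pole_factor. rewrite H0. simpl. unfold Rdiv. ring. }
    destruct Req_dec_T as [H1|H1].
    { simpl. rewrite H1. ring. }
    apply conic_through_poles; auto.
  + intros kE HE _ i. unfold pole_conic in HE.
    destruct Req_dec_T as [|H0]; [discriminate|]. destruct Req_dec_T as [|H1]; [discriminate|].
    injection HE as <-.
    (* Raising i by j + 1 moves the centre by 2(j + 1) half steps, that is by 2h, the step required
       by [pole_billiard]. *)
    set (q' := fun n => q (center i j + n * Z.of_nat (2 * (j + 1)))%Z).
    exists (fun n => (a * sn (q' n) * dn h / cn h, b * cn (q' n) / cn h)). split.
    * apply pole_billiard; auto.
      -- intros n; apply Jq.
      -- intros n. fold m. unfold q', h.
         replace (center i j + (n + 1) * Z.of_nat (2 * (j + 1)))%Z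
           with (center i j + n * Z.of_nat (2 * (j + 1)) + Z.of_nat (j + 1) + Z.of_nat (j + 1))%Z by lia.
         rewrite !(lattice_add m w) by auto. apply jadd_assoc; auto.
    * intros n. destruct (HS (i + n * Z.of_nat (j + 1))%Z) as (l & Hl & ->).
      replace (q (center (i + n * Z.of_nat (j + 1)) j)) with (q' n)
        by (unfold q', center; f_equal; destruct (Nat.even j); lia).
      (* The factor cn h accounts for normalizing the third coordinate of the pole to 1. *)
      exists (l * pole_factor m a b (q' n) h * cn h). split.
      -- do 2 (apply Rmult_integral_contrapositive_currified; auto).
         apply pole_factor_neq0; auto. apply Jq.
      -- unfold hom, hscale, chord_pole; cbn [hx hy hz fst snd]. f_equal; field; auto.
Qed.
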